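(* Let $G$ be a group, let $X=(V,E)$ be an oriented graph, and let $\mathcal{P}$ be a network $G$-torsor over $X$. Then $\mathcal{P}$ admits a global section if and only if $\mathcal{P}$ is isomorphic, as a network $G$-torsor, to the constant torsor $\underline{G}$ (the trivial network torsor); that is, if and only if the class of $\mathcal{P}$ in $H^1(X;\underline{G})$ is the identity (distinguished) element.
   Context: A network sheaf of sets $\mathcal{F}$ on $X=(V,E)$ assigns a set (stalk) $\mathcal{F}(v)$ to each vertex, a set $\mathcal{F}(e)$ to each edge, and a restriction map $\mathcal{F}_{v\to e}:\mathcal{F}(v)\to\mathcal{F}(e)$ to each incidence of a vertex $v$ with an edge $e$. A global section is a family $(\sigma_v)_{v\in V}$, $\sigma_v\in\mathcal{F}(v)$, with $\mathcal{F}_{u\to e}(\sigma_u)=\mathcal{F}_{v\to e}(\sigma_v)$ for every oriented edge $e=(u,v)$. A network $G$-torsor $\mathcal{P}$ over $X$ is a network sheaf of sets with all vertex and edge stalks non-empty, equipped with a free and transitive right $G$-action on each stalk, such that all restriction maps are $G$-equivariant: $\mathcal{P}_{v\to e}(p\cdot g)=\mathcal{P}_{v\to e}(p)\cdot g$. A morphism of network $G$-torsors $\Phi:\mathcal{P}\to\mathcal{P}'$ over $X$ is a family of $G$-equivariant maps $\Phi_x:\mathcal{P}(x)\to\mathcal{P}'(x)$, $x\in V\cup E$, commuting with the restriction maps; an isomorphism is a morphism with an inverse morphism. The constant torsor $\underline{G}$ has all stalks equal to $G$, acted on by right multiplication, with all restriction maps the identity. $H^1(X;\underline{G})$ is the pointed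 set of families $\eta=(\eta_e)_{e\in E}$, $\eta_e\in G$, modulo the relation $\eta\sim\eta'$ iff there is $(\xi_v)_{v\in V}$ with $\xi_v\in G$ and $\eta'_e=\xi_u^{-1}\eta_e\xi_v$ for every oriented edge $e=(u,v)$. The distinguished element is the class of $\eta_e\equiv 1$. The class of $\mathcal{P}$ in $H^1(X;\underline{G})$ is obtained by choosing $p_v\in\mathcal{P}(v)$ for each vertex $v$ and taking the class of $\eta$, where $\eta_e\in G$ is the unique element with $\mathcal{P}_{v\to e}(p_v)=\mathcal{P}_{u\to e}(p_u)\cdot\eta_e$ for $e=(u,v)$; this class does not depend on the choices. *)

(* Defs.v *)
From HB Require Import structures.
From mathcomp Require Import all_boot monoid.
From mathcomp Require Import boolp.

Set Implicit Arguments.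
Unset Strict Implicit.
Unset Printing Implicit Defensive.

Local Open Scope group_scope.
Local Open Scope quotient_scope.

(* The edge [e] is oriented from [src e] to [tgt e]. Neither finiteness nor
   the absence of parallel edges and self-loops is assumed. *)
Record oriented_graph := OrientedGraph {
  vertex : Type;
  edge : Type;
  src : edge -> vertex;
  tgt : edge -> vertex }.

(* The incidences of a vertex with an edge. A self-loop has two of them, one
   for each of its ends. *)
Inductive incidence (X : oriented_graph) : vertex X -> edge X -> Type :=
  | inc_src (e : edge X) : incidence (src e) e
  | inc_tgt (e : edge X) : incidence (tgt e) e.

Definition cell (X : oriented_graph) : Type := (vertex X + edge X)%type.

Record network_sheaf (X : oriented_graph) := NetworkSheaf {
  stalk :> cell X -> Type;
  res : forall (v : vertex X) (e : edge X),
    incidence v e -> stalk (inl v) -> stalk (inr e) }.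

Definition is_global_section (X : oriented_graph) (F : network_sheaf X)
    (s : forall v : vertex X, F (inl v)) : Prop :=
  forall e : edge X, res (inc_src e) (s (src e)) = res (inc_tgt e) (s (tgt e)).

Definition has_global_section (X : oriented_graph) (F : network_sheaf X) : Prop :=
  exists s : forall v : vertex X, F (inl v), is_global_section s.

Record network_torsor (G : groupType) (X : oriented_graph) := NetworkTorsor {
  torsor_sheaf :> network_sheaf X;
  act : forall x : cell X, torsor_sheaf x -> G -> torsor_sheaf x;
  stalk_nonempty : forall x : cell X, inhabited (torsor_sheaf x);
  act1 : forall (x : cell X) (p : torsor_sheaf x), act p 1 = p;
  actM : forall (x : cell X) (p : torsor_sheaf x) (g h : G),
    act p (g * h) = act (act p g) h;
  act_free : forall (x : cell X) (p : torsor_sheaf x) (g : G),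
    act p g = p -> g = 1;
  act_transitive : forall (x : cell X) (p q : torsor_sheaf x),
    exists g : G, q = act p g;
  res_equivariant : forall (v : vertex X) (e : edge X) (i : incidence v e)
    (p : torsor_sheaf (inl v)) (g : G),
    res i (act p g) = act (res i p) g }.

Record torsor_morphism (G : groupType) (X : oriented_graph)
    (P Q : network_torsor G X) := TorsorMorphism {
  tmor :> forall x : cell X, P x -> Q x;
  tmor_equivariant : forall (x : cell X) (p : P x) (g : G),
    tmor (act p g) = act (tmor p) g;
  tmor_res : forall (v : vertex X) (e : edge X) (i : incidence v e)
    (p : P (inl v)), tmor (res i p) = res i (tmor p) }.

Definition torsor_isomorphic (G : groupType) (X : oriented_graph)
    (P Q : network_torsor G X) : Prop :=
  exists (Phi : torsor_morphism P Q) (Psi : torsor_morphism Q P),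
    (forall (x : cell X) (p : P x), Psi x (Phi x p) = p) /\
    (forall (x : cell X) (q : Q x), Phi x (Psi x q) = q).

Section ConstantTorsor.
Variables (G : groupType) (X : oriented_graph).

Definition constant_sheaf : network_sheaf X :=
  @NetworkSheaf X (fun _ => G) (fun _ _ _ g => g).

Lemma mulg_free (x g : G) : x * g = x -> g = 1.
Proof. by move=> xg; apply: (mulgI x); rewrite xg mulg1. Qed.

Lemma mulg_transitive (x y : G) : exists g : G, y = x * g.
Proof. by exists (x^-1 * y); rewrite mulVKg. Qed.

Definition constant_torsor : network_torsor G X :=
  @NetworkTorsor G X constant_sheaf (fun _ p g => p * g)
    (fun _ => inhabits 1) (fun _ p => mulg1 p) (fun _ p g h => mulgA p g h)
    (fun _ p g => @mulg_free p g) (fun _ p q => mulg_transitive p q)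
    (fun _ _ _ _ _ => erefl).

End ConstantTorsor.

Section H1.
Variables (G : groupType) (X : oriented_graph).

Definition cochain1 : Type := edge X -> G.
HB.instance Definition _ := Choice.on cochain1.

Definition cohomologous (eta eta' : cochain1) : Prop :=
  exists xi : vertex X -> G,
    forall e : edge X, eta' e = (xi (src e))^-1 * eta e * xi (tgt e).

Definition cohomologousb : rel cochain1 := fun eta eta' => `[< cohomologous eta eta' >].

Lemma cohomologous_refl : reflexive cohomologousb.
Proof.
by move=> eta; apply/asboolP; exists (fun=> 1) => e; rewrite invg1 mul1g mulg1.
Qed.

Lemma cohomologous_symW eta eta' : cohomologous eta eta' -> cohomologous eta' eta.
Proof.
by case=> xi h; exists (fun v => (xi v)^-1) => e; rewrite h invgK -!mulgA mulgV mulg1 mulVKg.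
Qed.

Lemma cohomologous_sym : symmetric cohomologousb.
Proof. by move=> eta eta'; apply/asboolP/asboolP; apply: cohomologous_symW. Qed.

Lemma cohomologous_trans : transitive cohomologousb.
Proof.
move=> eta2 eta1 eta3 /asboolP[xi h] /asboolP[zeta k]; apply/asboolP.
by exists (fun v => xi v * zeta v) => e; rewrite k h invgM !mulgA.
Qed.

Canonical cohomologous_equiv : equiv_rel cochain1 :=
  EquivRel cohomologousb cohomologous_refl cohomologous_sym cohomologous_trans.

Definition H1 : Type := {eq_quot cohomologous_equiv}.

Definition H1_class (eta : cochain1) : H1 := \pi_{eq_quot cohomologous_equiv} eta.

Definition H1_point : H1 := H1_class (fun=> 1).

Lemma H1_classP (eta eta' : cochain1) :
  H1_class eta = H1_class eta' <-> cohomologous eta eta'.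
Proof.
split=> [/eqquotP /asboolP //|h].
by apply/eqquotP/asboolP.
Qed.

End H1.

Section TorsorClass.
Variables (G : groupType) (X : oriented_graph) (P : network_torsor G X).

(* The unique group element carrying [p] to [q]. *)
Definition torsor_diff (x : cell X) (p q : P x) : G :=
  sval (cid (act_transitive p q)).

Lemma torsor_diffP (x : cell X) (p q : P x) : q = act p (torsor_diff p q).
Proof. by rewrite /torsor_diff; case: cid. Qed.

Lemma act_inj (x : cell X) (p : P x) : injective (act p).
Proof.
move=> g h gh; have : act p (g * h^-1) = p by rewrite actM gh -actM mulgV act1.
by move/act_free => gh1; apply: (mulIg h^-1); rewrite gh1 mulgV.
Qed.

Lemma torsor_diff_unique (x : cell X) (p q : P x) (g : G) :
  q = act p g -> torsor_diff p q = g.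
Proof. by move=> qE; apply: (@act_inj x p); rewrite -torsor_diffP. Qed.

Definition torsor_cochain (p : forall v : vertex X, P (inl v)) : cochain1 G X :=
  fun e => torsor_diff (res (inc_src e) (p (src e))) (res (inc_tgt e) (p (tgt e))).

Definition vertex_choice (v : vertex X) : P (inl v) :=
  inhabited_witness (stalk_nonempty P (inl v)).

Definition torsor_class : H1 G X := H1_class (torsor_cochain vertex_choice).

Lemma torsor_classE (p : forall v : vertex X, P (inl v)) :
  torsor_class = H1_class (torsor_cochain p).
Proof.
apply/H1_classP; pose q := vertex_choice.
exists (fun v => torsor_diff (q v) (p v)) => e.
rewrite /torsor_cochain; apply: torsor_diff_unique.
rewrite {1}(torsor_diffP (q (tgt e)) (p (tgt e))) res_equivariant.
rewrite {1}(torsor_diffP (res (inc_src e) (q (src e))) (res (inc_tgt e) (q (tgt e)))).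
rewrite [in RHS](torsor_diffP (q (src e)) (p (src e))) res_equivariant -!actM.
rewrite -(torsor_diffP (q (src e)) (p (src e))).
by rewrite !mulgA mulgV mul1g.
Qed.

End TorsorClass.

(* Main.v *)
Require Import Defs.
From mathcomp Require Import all_boot monoid.

(** A global section [s] gives a base point in every stalk: [s v] at a vertex
    [v], and at an edge [e] the common value of the two restrictions. These base
    points are preserved by the restriction maps, so translating them by [G]
    gives an isomorphism from the constant torsor to [P]; its inverse sends a
    point to its difference with the base point. Conversely, a morphism out of
    the constant torsor sends the constant section [1] to a global section.

    On the cohomological side, the cochain of a global section is trivial, and
    the class of [P] may be computed from any choice of vertex points. If
    conversely [xi] trivializes the cochain of the points [p v], then translating
    each [p v] by [xi v] gives a global section. *)

Set Implicit Arguments.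
Unset Strict Implicit.
Unset Printing Implicit Defensive.

Local Open Scope group_scope.

Section GlobalSections.
Variables (G : groupType) (X : oriented_graph) (P : network_torsor G X).

Lemma torsor_diff_act (x : cell X) (p q : P x) (g : G) :
  torsor_diff p (act q g) = torsor_diff p q * g.
Proof. by apply: torsor_diff_unique; rewrite actM -torsor_diffP. Qed.

(** The extension of a vertex section to all cells. On an edge it is read off
    from the source; for a global section the target gives the same value. *)
Definition cell_section (s : forall v : vertex X, P (inl v)) (x : cell X) : P x :=
  match x with
  | inl v => s v
  | inr e => res (inc_src e) (s (src e))
  end.

Lemma res_cell_section (s : forall v : vertex X, P (inl v)) :
  is_global_section s ->
  forall (v : vertex X) (e : edge X) (i : incidence v e),
    res i (s v) = cell_section s (inr e).
Proof. by move=> sP v e [] {}e //=; rewrite sP. Qed.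

Lemma isomorphic_of_global_section :
  has_global_section P -> torsor_isomorphic P (constant_torsor G X).
Proof.
case=> s /res_cell_section sP; pose b := cell_section s.
have diff_res v e (i : incidence v e) (p : P (inl v)) :
    torsor_diff (b (inr e)) (res i p) = torsor_diff (b (inl v)) p.
  apply: torsor_diff_unique.
  by rewrite [b (inr e)]/b -(sP v e i) -res_equivariant -torsor_diffP.
have act_res v e (i : incidence v e) (g : G) :
    act (b (inr e)) g = res i (act (b (inl v)) g).
  by rewrite res_equivariant (sP v e i).
pose Phi := @TorsorMorphism G X P (constant_torsor G X)
  (fun x => torsor_diff (b x)) (fun x => @torsor_diff_act x (b x)) diff_res.
pose Psi := @TorsorMorphism G X (constant_torsor G X) P
  (fun x => act (b x)) (fun x => actM (b x)) act_res.
exists Phi, Psi; split=> [x p | x g] /=; first by rewrite -torsor_diffP.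
exact: torsor_diff_unique.
Qed.

Lemma global_section_of_morphism :
  torsor_morphism (constant_torsor G X) P -> has_global_section P.
Proof.
move=> Psi; exists (fun v => Psi (inl v) (1 : G)) => e.
by rewrite -!tmor_res.
Qed.

Lemma torsor_class_of_global_section :
  has_global_section P -> torsor_class P = H1_point G X.
Proof.
case=> s sP; rewrite (torsor_classE s); apply/H1_classP.
exists (fun=> 1) => e; rewrite invg1 mul1g mulg1; apply/esym.
by apply: torsor_diff_unique; rewrite act1 sP.
Qed.

Lemma global_section_of_torsor_class :
  torsor_class P = H1_point G X -> has_global_section P.
Proof.
case/H1_classP=> xi xiP; pose p := vertex_choice P.
exists (fun v => act (p v) (xi v)) => e; rewrite !res_equivariant.
rewrite [res (inc_tgt e) _](torsor_diffP (res (inc_src e) (p (src e)))) -actM.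
(* Triviality reads [1 = (xi u)^-1 * eta e * xi v], so [eta e * xi v = xi u]. *)
by congr act; apply: (mulgI (xi (src e))^-1); rewrite mulVg mulgA -xiP.
Qed.

End GlobalSections.

Theorem proposition4p5 (G : groupType) (X : oriented_graph)
    (P : network_torsor G X) :
  (has_global_section P <-> torsor_isomorphic P (constant_torsor G X)) /\
  (torsor_isomorphic P (constant_torsor G X) <-> torsor_class P = H1_point G X).
Proof.
have iso_section : torsor_isomorphic P (constant_torsor G X) -> has_global_section P.
  by case=> _ [Psi _]; apply: global_section_of_morphism.
split; split=> [|].
- exact: isomorphic_of_global_section.
- exact: iso_section.
- by move/iso_section; apply: torsor_class_of_global_section.
- by move/global_section_of_torsor_class; apply: isomorphic_of_global_section.
Qed.
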